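(* Let $y=F(y;z,v)$ with $F(y;z,v)=\sum_{n,m,k}a_{n,m,k}z^ny^mv^k$, $a_{n,m,k}\ge0$, be an equation that is analytically well-founded at the valuation $v_0=1$. Let $(y_0,z_0)$, with $y_0>0,z_0>0$, be the solution of the system $y=F(y;z,1)$, $1=F_y(y;z,1)$, and put $$\mu=\frac{F_v}{z_0F_z},$$ $$\sigma^2=\mu+\mu^2+\frac{1}{z_0F_z^3F_{yy}}\Big(F_z^2(F_{yy}F_{vv}-F_{yv}^2)-2F_zF_v(F_{yy}F_{zv}-F_{yz}F_{yv})+F_v^2(F_{yy}F_{zz}-F_{yz}^2)\Big),$$ where all partial derivatives are evaluated at $(y_0;z_0,1)$. Suppose that there are three triples of integers $(n_j,m_j,k_j)$, $j=1,2,3$, with $m_j>0$ for $j=1,2,3$ and $$\left|\begin{array}{rrr} n_1&m_1-1&k_1\\ n_2&m_2-1&k_2\\ n_3&m_3-1&k_3\end{array}\right|\neq0,$$ such that $a_{n_j,m_j,k_j}\neq0$ for $j=1,2,3$. Then $\sigma^2>0$.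
   Context: Here $F(y;z,v)$ is a power series in $y,z,v$ with nonnegative coefficients. The equation $y=F(y;z,v)$ is called analytically well-founded at $v_0=1$ if: (1) $v_0=1$ is an admissible valuation, i.e. each coefficient $[y^mz^n]F(y;z,1)$ is finite (and nonnegative), and $F(0;z,1)\not\equiv0$; (2) $F$ is not affine in $y$ and depends on $z$, i.e. $\partial^2F/\partial y^2\neq0$ and $\partial F/\partial z\ne0$ as power series; (3) there exist $z_0>0$ and $y_0>0$ such that $(y_0;z_0,1)$ is an inner point of the region of convergence of $F(y;z,v)$ and $y_0=F(y_0;z_0,1)$, $1=F_y(y_0;z_0,1)$. Subscripts denote partial derivatives. *)

(* Defs.v *)
From HB Require Import structures.
From mathcomp Require Import all_boot all_order all_algebra.
From mathcomp Require Import all_classical all_reals all_analysis.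
Set Implicit Arguments.
Unset Strict Implicit.
Unset Printing Implicit Defensive.
Import Order.TTheory GRing.Theory Num.Theory.
Import numFieldNormedType.Exports.
Local Open Scope classical_set_scope.
Local Open Scope ring_scope.

(* A power series F(y;z,v) = \sum_(n,m,k) a_{n,m,k} z^n y^m v^k is given by its
   coefficients.  Order of the indices: n is the exponent of z, m that of y,
   k that of v.  Order of the variables: y, z, v. *)
Definition pser3 (R : realType) : Type := nat -> nat -> nat -> R.

Section PowerSeries.
Context {R : realType}.
Implicit Types (a : pser3 R) (f : R -> R -> R -> R).

Definition pser3_term a (y z v : R) (n m k : nat) : R :=
  a n m k * z ^+ n * y ^+ m * v ^+ k.

(* Convergence of a multiple series means absolute convergence. *)
Definition conv_region a : set (R * R * R) :=
  [set p | summable [set: nat * nat * nat]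
     (fun i => (pser3_term a p.1.1 p.1.2 p.2 i.1.1 i.1.2 i.2)%:E)].

(* The value of the series, as the limit of its cubic partial sums; on
   conv_region every order of summation gives this value.  Outside
   conv_region it is meaningless. *)
Definition pser3_eval a (y z v : R) : R :=
  limn (fun N : nat => \sum_(n < N) \sum_(m < N) \sum_(k < N)
                          pser3_term a y z v n m k).

Definition partial_y f : R -> R -> R -> R :=
  fun y z v => derive1 (fun t => f t z v) y.
Definition partial_z f : R -> R -> R -> R :=
  fun y z v => derive1 (fun t => f y t v) z.
Definition partial_v f : R -> R -> R -> R :=
  fun y z v => derive1 (fun t => f y z t) v.

(* Partial derivatives in the ring of power series, on coefficients. *)
Definition pser3_dy a : pser3 R := fun n m k => m.+1%:R * a n m.+1 k.
Definition pser3_dz a : pser3 R := fun n m k => n.+1%:R * a n.+1 m k.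

Definition pser3_neq0 a : Prop := exists n m k, a n m k != 0.

(* The coefficient [y^m z^n] F(y;z,1), possibly +oo; the terms are meant to be
   nonnegative. *)
Definition coef_at1 a (m n : nat) : \bar R :=
  (\sum_(0 <= k <oo) (a n m k)%:E)%E.

Definition admissible_at1 a : Prop :=
  (forall m n, (0 <= coef_at1 a m n < +oo)%E) /\
  (exists n, coef_at1 a 0 n != 0%E).

Definition characteristic_point a (y0 z0 : R) : Prop :=
  [/\ 0 < y0, 0 < z0,
      (conv_region a)° (y0, z0, 1),
      y0 = pser3_eval a y0 z0 1 &
      1 = partial_y (pser3_eval a) y0 z0 1].

Definition analytically_well_founded_at1 a : Prop :=
  [/\ admissible_at1 a,
      pser3_neq0 (pser3_dy (pser3_dy a)),
      pser3_neq0 (pser3_dz a) &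
      exists y0 z0 : R, characteristic_point a y0 z0].

Definition mu a (y0 z0 : R) : R :=
  let F := pser3_eval a in
  partial_v F y0 z0 1 / (z0 * partial_z F y0 z0 1).

Definition sigma2 a (y0 z0 : R) : R :=
  let F := pser3_eval a in
  let Fz := partial_z F y0 z0 1 in
  let Fv := partial_v F y0 z0 1 in
  let Fyy := partial_y (partial_y F) y0 z0 1 in
  let Fyz := partial_z (partial_y F) y0 z0 1 in
  let Fyv := partial_v (partial_y F) y0 z0 1 in
  let Fzz := partial_z (partial_z F) y0 z0 1 in
  let Fzv := partial_v (partial_z F) y0 z0 1 in
  let Fvv := partial_v (partial_v F) y0 z0 1 in
  mu a y0 z0 + mu a y0 z0 ^+ 2 +
  1 / (z0 * Fz ^+ 3 * Fyy) *
    (Fz ^+ 2 * (Fyy * Fvv - Fyv ^+ 2)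
     - 2 * Fz * Fv * (Fyy * Fzv - Fyz * Fyv)
     + Fv ^+ 2 * (Fyy * Fzz - Fyz ^+ 2)).

End PowerSeries.

(* Row j is (n_j, m_j - 1, k_j), with subtraction in int. *)
Definition exponent_mx (n m k : 'I_3 -> nat) : 'M[int]_3 :=
  \matrix_(j < 3, c < 3)
    [:: (n j)%:Z; (m j)%:Z - 1; (k j)%:Z]`_c.

(* Main.v *)
Require Import Defs.
From HB Require Import structures.
From mathcomp Require Import all_boot all_order all_algebra.
From mathcomp Require Import all_classical all_reals all_analysis.
From mathcomp Require Import ring lra.
Import Order.TTheory GRing.Theory Num.Theory.
Import numFieldNormedType.Exports.
Local Open Scope classical_set_scope.
Local Open Scope ring_scope.

(* Put [w = a_{n,m,k} z0^n y0^m], normalized to a probability measure on the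
   exponents.  The two equations of the characteristic system say that the
   total mass is [y0] and that [m] has mean 1; the derivatives of [F] at
   [(y0;z0,1)] are factorial moments of [w].  With [X = k - mu n], which has
   mean 0, this gives
     sigma^2 = (E[X^2] - E[X (m-1)]^2 / E[(m-1)^2]) / E[n],
   i.e. [E[n] sigma^2 = E[(X - la (m-1))^2]] for the regression coefficient
   [la = E[X (m-1)] / E[(m-1)^2]].  It vanishes only if
   [k - mu n - la (m-1) = 0] on the whole support of [a], which the nonzero
   determinant excludes.
   All series have nonnegative terms at nonnegative points, so they can be
   differentiated term by term as soon as they are bounded at a larger point. *)

(** * Cubic partial sums of families indexed by triples *)

Section CubicSums.
Context {R : realType}.
Implicit Types (G H c : nat -> nat -> nat -> R) (d e : nat -> nat -> nat -> nat).

(** The same nested sums as in [pser3_eval], so that [pser3_evalE] holds by conversion. *)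
Definition cubic_sum G (N : nat) : R :=
  \sum_(n < N) \sum_(m < N) \sum_(k < N) G n m k.

(** Only an upper bound: for nonnegative terms it already gives convergence, and it passes to
    termwise smaller families. *)
Definition bounded_sums G : Prop := exists M, forall N, cubic_sum G N <= M.

Lemma eq_cubic_sum G H :
  (forall n m k, G n m k = H n m k) -> cubic_sum G = cubic_sum H.
Proof.
move=> GH; apply/funext => N; apply: eq_bigr => n _; apply: eq_bigr => m _.
by apply: eq_bigr => k _.
Qed.

Lemma cubic_sumD G H N :
  cubic_sum (fun n m k => G n m k + H n m k) N = cubic_sum G N + cubic_sum H N.
Proof.
rewrite -big_split; apply: eq_bigr => n _; rewrite -big_split.
by apply: eq_bigr => m _; rewrite -big_split.
Qed.

Lemma cubic_sumB G H N :
  cubic_sum (fun n m k => G n m k - H n m k) N = cubic_sum G N - cubic_sum H N.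
Proof.
rewrite -sumrB; apply: eq_bigr => n _; rewrite -sumrB.
by apply: eq_bigr => m _; rewrite -sumrB.
Qed.

Lemma cubic_sumZ x G N :
  cubic_sum (fun n m k => x * G n m k) N = x * cubic_sum G N.
Proof.
rewrite mulr_sumr; apply: eq_bigr => n _; rewrite mulr_sumr.
by apply: eq_bigr => m _; rewrite mulr_sumr.
Qed.

Lemma cvg_cubic_sumD {G H l l'} :
  cubic_sum G @ \oo --> l -> cubic_sum H @ \oo --> l' ->
  cubic_sum (fun n m k => G n m k + H n m k) @ \oo --> l + l'.
Proof. by rewrite (funext (cubic_sumD G H)); exact: cvgD. Qed.

Lemma cvg_cubic_sumZ x {G l} : cubic_sum G @ \oo --> l ->
  cubic_sum (fun n m k => x * G n m k) @ \oo --> x * l.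
Proof. by rewrite (funext (cubic_sumZ x G)); exact: cvgM (cvg_cst x). Qed.

Lemma ler_cubic_sum G H N :
  (forall n m k, G n m k <= H n m k) -> cubic_sum G N <= cubic_sum H N.
Proof.
by move=> GH; apply: ler_sum => n _; apply: ler_sum => m _; apply: ler_sum.
Qed.

Lemma ler_norm_cubic_sum G H N :
  (forall n m k, `|G n m k| <= H n m k) -> `|cubic_sum G N| <= cubic_sum H N.
Proof.
move=> GH.
apply: le_trans (ler_norm_sum _ _ _) _; apply: ler_sum => n _.
apply: le_trans (ler_norm_sum _ _ _) _; apply: ler_sum => m _.
by apply: le_trans (ler_norm_sum _ _ _) _; apply: ler_sum.
Qed.

Lemma cubic_sum_nondecreasing G :
  (forall n m k, 0 <= G n m k) -> nondecreasing_seq (cubic_sum G).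
Proof.
move=> G0; apply/nondecreasing_seqP => N; rewrite /cubic_sum.
have S0 n m K : 0 <= \sum_(k < K) G n m k by apply: sumr_ge0.
have SS0 n M K : 0 <= \sum_(m < M) \sum_(k < K) G n m k by apply: sumr_ge0.
rewrite big_ord_recr; apply: ler_wpDr; first exact: sumr_ge0.
apply: ler_sum => n _.
rewrite big_ord_recr; apply: ler_wpDr; first exact: sumr_ge0.
by apply: ler_sum => m _; rewrite big_ord_recr; apply: ler_wpDr.
Qed.

Lemma term_le_cubic_sum G (n m k N : nat) :
  (forall n m k, 0 <= G n m k) -> (n < N)%N -> (m < N)%N -> (k < N)%N ->
  G n m k <= cubic_sum G N.
Proof.
move=> G0 nN mN kN; rewrite /cubic_sum.
have S0 n' m' K : 0 <= \sum_(k < K) G n' m' k by apply: sumr_ge0.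
have SS0 n' M K : 0 <= \sum_(m < M) \sum_(k < K) G n' m k by apply: sumr_ge0.
rewrite (bigD1 (Ordinal nN))//=; apply: ler_wpDr.
  by apply: sumr_ge0 => i _; exact: SS0.
rewrite (bigD1 (Ordinal mN))//=; apply: ler_wpDr.
  by apply: sumr_ge0 => i _; exact: S0.
by rewrite (bigD1 (Ordinal kN))//=; apply: ler_wpDr => //; exact: sumr_ge0.
Qed.

Lemma cubic_sum_cvg G : (forall n m k, 0 <= G n m k) -> bounded_sums G ->
  cubic_sum G @ \oo --> limn (cubic_sum G).
Proof.
move=> G0 [M GM]; apply: nondecreasing_is_cvgn.
  exact: cubic_sum_nondecreasing.
by exists M => _ [N _ <-].
Qed.

(** One positive term thus forces a positive limit; the strict inequalities of the final proof come
    from here. *)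
Lemma term_le_cubic_lim G l (n m k : nat) :
  (forall n m k, 0 <= G n m k) -> cubic_sum G @ \oo --> l -> G n m k <= l.
Proof.
move=> G0 Gl; have ndG := cubic_sum_nondecreasing G G0.
have := nondecreasing_cvgn_le ndG (cvgP _ Gl) (maxn n (maxn m k)).+1.
rewrite (cvg_lim _ Gl)//; apply: le_trans; apply: term_le_cubic_sum => //.
all: by rewrite ltnS ?leq_max ?leqnn ?orbT.
Qed.

Lemma bounded_sums_le G H :
  (forall n m k, G n m k <= H n m k) -> bounded_sums H -> bounded_sums G.
Proof.
move=> GH [M HM]; exists M => N.
by apply: le_trans (ler_cubic_sum _ _ N GH) _.
Qed.

Lemma bounded_sumsZ x G : 0 <= x -> bounded_sums G ->
  bounded_sums (fun n m k => x * G n m k).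
Proof.
move=> x0 [M GM]; exists (x * M) => N.
by rewrite cubic_sumZ ler_wpM2l.
Qed.

(** * Tangent bounds for powers and term-by-term differentiation *)

Lemma exprn_tangentS (s t : R) (d : nat) :
  s ^+ d.+1 - t ^+ d.+1 - (s - t) * (d.+1%:R * t ^+ d) =
  s * (s ^+ d - t ^+ d - (s - t) * (d%:R * t ^+ d.-1)) +
  (s - t) ^+ 2 * (d%:R * t ^+ d.-1).
Proof. by case: d => [|d] /=; rewrite ?exprS; ring. Qed.

(** Convexity of powers: in [exprn_tangentS] the gap at [d.+1] is [s] times the gap at [d] plus a
    nonnegative term. *)
Lemma exprn_tangent_ge0 (s t : R) (d : nat) : 0 <= s -> 0 <= t ->
  0 <= s ^+ d - t ^+ d - (s - t) * (d%:R * t ^+ d.-1).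
Proof.
move=> s0 t0; elim: d => [|d IH]; first by rewrite !expr0 mul0r mulr0; lra.
rewrite exprn_tangentS; apply: addr_ge0; apply: mulr_ge0 => //; first exact: sqr_ge0.
by rewrite mulr_ge0 ?exprn_ge0.
Qed.

(** A Taylor remainder bounded by the second derivative at [r], without the factor 1/2. This slack
    lets the induction close: after shifting [d], it only remains that
    [(d + 1)^2 <= (d + 2)(d + 1)]. *)
Lemma exprn_tangent_le (s t r : R) (d : nat) :
  0 <= s <= r -> 0 <= t <= r ->
  s ^+ d - t ^+ d - (s - t) * (d%:R * t ^+ d.-1) <=
  (s - t) ^+ 2 * (d%:R * (d.-1%:R * r ^+ d.-1.-1)).
Proof.
move=> /andP[s0 sr] /andP[t0 tr]; elim: d => [|d IH].
  by rewrite !expr0 !mul0r !mulr0; lra.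
rewrite exprn_tangentS /=.
have r0 : 0 <= r by apply: le_trans tr.
have D0 := exprn_tangent_ge0 s t d s0 t0.
have h1 : s * (s ^+ d - t ^+ d - (s - t) * (d%:R * t ^+ d.-1)) <=
   r * ((s - t) ^+ 2 * (d%:R * (d.-1%:R * r ^+ d.-1.-1))).
  by apply: ler_pM.
have h2 : (s - t) ^+ 2 * (d%:R * t ^+ d.-1) <= (s - t) ^+ 2 * (d%:R * r ^+ d.-1).
  by rewrite !ler_wpM2l ?sqr_ge0 ?lerXn2r ?nnegrE.
apply: le_trans (lerD h1 h2) _.
rewrite mulrCA -mulrDr; apply: ler_wpM2l; first exact: sqr_ge0.
case: d {IH D0 h1 h2} => [|d]; first by rewrite !mul0r; lra.
have -> : r * (d.+1%:R * (d.+1.-1%:R * r ^+ d.+1.-1.-1)) = d.+1%:R * (d%:R * r ^+ d).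
  by case: d => [|d] /=; rewrite ?exprS; ring.
rewrite -mulrDr /=.
have -> : d%:R * r ^+ d + r ^+ d = d.+1%:R * r ^+ d by rewrite -natr1; ring.
by apply: ler_wpM2r; [rewrite mulr_ge0 ?exprn_ge0|rewrite ler_nat].
Qed.

(** The tangent at [t] gives [(r - t) d t^(d-1) <= r^d - t^d <= r^d], so the differentiated series
    is dominated by the series at [r] divided by [r - t]. *)
Lemma bounded_sums_diff c d (t r : R) :
  (forall n m k, 0 <= c n m k) -> 0 <= t < r ->
  bounded_sums (fun n m k => c n m k * r ^+ d n m k) ->
  bounded_sums (fun n m k => c n m k * (d n m k)%:R * t ^+ (d n m k).-1).
Proof.
move=> c0 /andP[t0 tr] cr.
have rt : 0 <= (r - t)^-1 by rewrite invr_ge0; lra.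
apply: bounded_sums_le (bounded_sumsZ _ _ rt cr) => n m k.
rewrite mulrCA -mulrA ler_wpM2l// ler_pdivlMl ?subr_gt0//.
have := exprn_tangent_ge0 r t (d n m k) (le_trans t0 (ltW tr)) t0.
have := exprn_ge0 (d n m k) t0; lra.
Qed.

(** The second-derivative series stays bounded at a radius [r'] between [t] and [r], which makes the
    error of the difference quotients linear in the step. The exponent [d] is an arbitrary function
    of the indices, so that any of the three variables can move. *)
Lemma cvg_derive1_cubic_lim c d (t r : R) :
  (forall n m k, 0 <= c n m k) -> 0 < t < r ->
  bounded_sums (fun n m k => c n m k * r ^+ d n m k) ->
  cubic_sum (fun n m k => c n m k * (d n m k)%:R * t ^+ (d n m k).-1) @ \oo -->
  derive1 (fun s => limn (cubic_sum (fun n m k => c n m k * s ^+ d n m k))) t.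
Proof.
move=> c0 /andP[t0 tr] cr.
pose r' := (t + r) / 2.
have [tr' r'r] : t < r' /\ r' < r by rewrite /r'; split; lra.
have cd0 n m k : 0 <= c n m k * (d n m k)%:R by rewrite mulr_ge0.
have cdd0 n m k : 0 <= c n m k * (d n m k)%:R * (d n m k).-1%:R by rewrite mulr_ge0.
have cvgs s : 0 <= s <= r ->
  cubic_sum (fun n m k => c n m k * s ^+ d n m k) @ \oo -->
    limn (cubic_sum (fun n m k => c n m k * s ^+ d n m k)).
  move=> /andP[s0 sr]; apply: cubic_sum_cvg => [n m k|].
    by rewrite mulr_ge0 ?exprn_ge0.
  apply: bounded_sums_le cr => n m k.
  by apply: ler_wpM2l => //; rewrite lerXn2r ?nnegrE ?(le_trans s0).
have cvgd : cubic_sum (fun n m k => c n m k * (d n m k)%:R * t ^+ (d n m k).-1)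
    @ \oo --> limn (cubic_sum
      (fun n m k => c n m k * (d n m k)%:R * t ^+ (d n m k).-1)).
  apply: cubic_sum_cvg => [n m k|].
    by rewrite mulr_ge0 ?exprn_ge0// ltW.
  by apply: bounded_sums_diff cr => //; rewrite ltW.
have [M HM] : bounded_sums (fun n m k =>
    c n m k * (d n m k)%:R * (d n m k).-1%:R * r' ^+ (d n m k).-1.-1).
  (* Each differentiation costs some room: one use of [bounded_sums_diff] goes from [r] down to
     [r2], the other from [r2] down to [r']. *)
  pose r2 := (r' + r) / 2.
  apply: (bounded_sums_diff (fun n m k => c n m k * (d n m k)%:R)
           (fun n m k => (d n m k).-1) r' r2) => //; first by rewrite /r2; lra.
  by apply: bounded_sums_diff cr => //; rewrite /r2; lra.
(* The partial sums lie within [(s - t)^2 M] of their tangents at [t], with [M]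
   independent of the number of terms; so does the limit. *)
have quad s : 0 <= s <= r' ->
  `|limn (cubic_sum (fun n m k => c n m k * s ^+ d n m k)) -
    limn (cubic_sum (fun n m k => c n m k * t ^+ d n m k)) -
    (s - t) * limn (cubic_sum
      (fun n m k => c n m k * (d n m k)%:R * t ^+ (d n m k).-1))|
  <= (s - t) ^+ 2 * M.
  move=> /andP[s0 sr'].
  have /cvgs cs : 0 <= s <= r by lra.
  have /cvgs ct : 0 <= t <= r by lra.
  have cc : (cubic_sum (fun n m k => c n m k * s ^+ d n m k) N -
    cubic_sum (fun n m k => c n m k * t ^+ d n m k) N -
    (s - t) * cubic_sum
      (fun n m k => c n m k * (d n m k)%:R * t ^+ (d n m k).-1) N) @[N --> \oo] -->
   limn (cubic_sum (fun n m k => c n m k * s ^+ d n m k)) -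
    limn (cubic_sum (fun n m k => c n m k * t ^+ d n m k)) -
    (s - t) * limn (cubic_sum
      (fun n m k => c n m k * (d n m k)%:R * t ^+ (d n m k).-1)).
    exact: (cvgB (cvgB cs ct) (cvgM (cvg_cst (s - t)) cvgd)).
  apply: (cvgr_to_le (cvg_norm cc)); apply: nearW => N.
  rewrite /= -cubic_sumZ -!cubic_sumB.
  apply: le_trans (ler_wpM2l (sqr_ge0 _) (HM N)).
  rewrite -cubic_sumZ; apply: ler_norm_cubic_sum => n m k.
  set D := d n m k; set C := c n m k; have C0 : 0 <= C := c0 n m k.
  have -> : C * s ^+ D - C * t ^+ D - (s - t) * (C * D%:R * t ^+ D.-1) =
    C * (s ^+ D - t ^+ D - (s - t) * (D%:R * t ^+ D.-1)) by ring.
  rewrite ger0_norm ?mulr_ge0// ?exprn_tangent_ge0 ?(ltW t0)//.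
  have -> : (s - t) ^+ 2 * (C * D%:R * D.-1%:R * r' ^+ D.-1.-1) =
    C * ((s - t) ^+ 2 * (D%:R * (D.-1%:R * r' ^+ D.-1.-1))) by ring.
  by apply: ler_wpM2l => //; apply: exprn_tangent_le; lra.
suff -> : derive1
    (fun s => limn (cubic_sum (fun n m k => c n m k * s ^+ d n m k))) t =
  limn (cubic_sum (fun n m k => c n m k * (d n m k)%:R * t ^+ (d n m k).-1)) by [].
rewrite /derive1; apply: cvg_lim => //; apply/cvgrPdist_le => /= e e0.
have M1 : 0 < `|M| + 1 by rewrite ltr_pwDr.
near=> h.
have h0 : h != 0 by near: h; exact: nbhs_dnbhs_neq.
(* The first two bounds keep [h + t] in [[0, r']], where [quad] applies; the third makes [|h| * M]
   at most [e], with [|M| + 1] as a positive denominator. *)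
have hs : `|h| <= Num.min (Num.min t (r' - t)) (e / (`|M| + 1)).
  near: h; apply: dnbhs0_le.
  by rewrite !lt_min t0 subr_gt0 tr' divr_gt0.
move: hs; rewrite !le_min -andbA => /and3P[ht hr he].
have := quad (h + t); rewrite addrK.
set L := limn _; set L0 := limn _; set L' := limn _ => /(_ _) q.
have {}q : `|L - L0 - h * L'| <= h ^+ 2 * M.
  by apply: q; move: ht hr; rewrite !ler_norml; lra.
have -> : L' - h^-1 *: (L - L0) = - (h^-1 * (L - L0 - h * L')).
  by rewrite /GRing.scale /=; field.
rewrite normrN normrM normfV ler_pdivrMl ?normr_gt0//.
apply: le_trans q _; rewrite -real_normK ?num_real// expr2 -mulrA ler_wpM2l//.
move: he; rewrite ler_pdivlMr// => he; apply: le_trans he.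
by rewrite ler_wpM2l// ler_wpDr// ler_norm.
Unshelve. all: by end_near. Qed.

(** The factor [t] restores the power lost by differentiation, so that the derivative becomes a
    first moment of the weights [w]. *)
Lemma cvg_derive1_scaled c d w (f : R -> R) (t r : R) :
  (forall n m k, 0 <= c n m k) -> 0 < t < r ->
  bounded_sums (fun n m k => c n m k * r ^+ d n m k) ->
  (forall s, f s = limn (cubic_sum (fun n m k => c n m k * s ^+ d n m k))) ->
  (forall n m k, w n m k = c n m k * t ^+ d n m k) ->
  cubic_sum (fun n m k => w n m k * (d n m k)%:R) @ \oo --> t * derive1 f t.
Proof.
move=> c0 tr cr fE wE; have df := cvg_derive1_cubic_lim c d t r c0 tr cr.
rewrite (funext fE).
have -> : cubic_sum (fun n m k => w n m k * (d n m k)%:R) = fun N => t *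
    cubic_sum (fun n m k => c n m k * (d n m k)%:R * t ^+ (d n m k).-1) N.
  apply/funext => N; rewrite -cubic_sumZ; congr (_ N); apply: eq_cubic_sum => n m k.
  by rewrite wE; case: (d n m k) => [|j] /=; rewrite ?exprS; ring.
exact: (cvgM (cvg_cst t) df).
Qed.

(** This is [cvg_derive1_scaled] for the differentiated series, whose exponents are [d.-1]; one more
    factor [t] gives the second factorial moment of [w]. *)
Lemma cvg_derive1_derive1_scaled c d w (f : R -> R) (t r : R) :
  (forall n m k, 0 <= c n m k) -> 0 < t < r ->
  bounded_sums (fun n m k => c n m k * r ^+ d n m k) ->
  (forall s, f s = limn (cubic_sum (fun n m k => c n m k * s ^+ d n m k))) ->
  (forall n m k, w n m k = c n m k * t ^+ d n m k) ->
  cubic_sum (fun n m k => w n m k * ((d n m k)%:R * ((d n m k)%:R - 1))) @ \oo -->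
  t ^+ 2 * derive1 (derive1 f) t.
Proof.
move=> c0 /andP[t0 tr] cr fE wE.
pose r' := (t + r) / 2.
have [tr' r'r] : t < r' /\ r' < r by rewrite /r'; split; lra.
pose f' s := limn (cubic_sum
  (fun n m k => c n m k * (d n m k)%:R * s ^+ (d n m k).-1)).
(* Term-by-term differentiation is available for [0 < s < r] only, so [derive1 f] and [f'] are
   identified near [t], which suffices for the derivative at [t]. *)
have -> : derive1 (derive1 f) t = derive1 f' t.
  rewrite !derive1E; apply: near_eq_derive; near=> s.
  have sr : 0 < s < r.
    by apply/andP; split; near: s; [exact: lt_nbhsr|exact: lt_nbhsl].
  rewrite (funext fE); apply/esym/cvg_lim => //.
  exact: (cvg_derive1_cubic_lim c d s r).
have cr' : bounded_sums
    (fun n m k => c n m k * (d n m k)%:R * r' ^+ (d n m k).-1).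
  by apply: bounded_sums_diff cr => //; lra.
have cd0 n m k : 0 <= c n m k * (d n m k)%:R by rewrite mulr_ge0.
pose w' n m k := c n m k * (d n m k)%:R * t ^+ (d n m k).-1.
have tr'0 : 0 < t < r' by rewrite t0.
have H := cvg_derive1_scaled _ (fun n m k => (d n m k).-1) w' f' t r' cd0 tr'0 cr'
  (fun=> erefl) (fun _ _ _ => erefl).
have -> : cubic_sum (fun n m k => w n m k * ((d n m k)%:R * ((d n m k)%:R - 1))) =
    fun N => t * cubic_sum (fun n m k => w' n m k * ((d n m k).-1)%:R) N.
  apply/funext => N; rewrite -cubic_sumZ; congr (_ N); apply: eq_cubic_sum => n m k.
  rewrite wE /w'; case: (d n m k) => [|j] /=; first ring.
  by rewrite exprS -natr1; ring.
rewrite expr2 -mulrA; exact: (cvgM (cvg_cst t) H).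
Unshelve. all: by end_near. Qed.

(** Differentiating in the first variable leaves a series in [y] with nonnegative coefficients [c'],
    to which the one-variable result applies. *)
Lemma cvg_derive1_derive1_mixed c d e w (f : R -> R -> R) (t r s q : R) :
  (forall n m k, 0 <= c n m k) -> 0 < t < r -> 0 < s < q ->
  bounded_sums (fun n m k => c n m k * r ^+ d n m k * q ^+ e n m k) ->
  (forall x y, f x y = limn (cubic_sum
     (fun n m k => c n m k * x ^+ d n m k * y ^+ e n m k))) ->
  (forall n m k, w n m k = c n m k * t ^+ d n m k * s ^+ e n m k) ->
  cubic_sum (fun n m k => w n m k * ((d n m k)%:R * (e n m k)%:R)) @ \oo -->
  t * s * derive1 (fun y => derive1 (f ^~ y) t) s.
Proof.
move=> c0 /andP[t0 tr] /andP[s0 sq] crq fE wE.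
pose c' n m k := c n m k * (d n m k)%:R * t ^+ (d n m k).-1.
pose f' y := limn (cubic_sum (fun n m k => c' n m k * y ^+ e n m k)).
have c'0 n m k : 0 <= c' n m k by rewrite !mulr_ge0 ?exprn_ge0 ?(ltW t0).
have -> : derive1 (fun y => derive1 (f ^~ y) t) s = derive1 f' s.
  rewrite !derive1E; apply: near_eq_derive; near=> y.
  have /andP[y0 yq] : 0 < y < q.
    by apply/andP; split; near: y; [exact: lt_nbhsr|exact: lt_nbhsl].
  have -> : f ^~ y = fun x => limn (cubic_sum
      (fun n m k => c n m k * y ^+ e n m k * x ^+ d n m k)).
    apply/funext => x; rewrite fE; congr (limn _); apply: eq_cubic_sum => n m k.
    by ring.
  have -> : f' y = limn (cubic_sum (fun n m k =>
      c n m k * y ^+ e n m k * (d n m k)%:R * t ^+ (d n m k).-1)).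
    by congr (limn _); apply: eq_cubic_sum => n m k; rewrite /c'; ring.
  apply/esym/cvg_lim => //.
  apply: (cvg_derive1_cubic_lim (fun n m k => c n m k * y ^+ e n m k) d t r).
  - by move=> n m k; rewrite mulr_ge0 ?exprn_ge0 ?(ltW y0).
  - by rewrite t0.
  apply: bounded_sums_le crq => n m k; rewrite mulrAC.
  apply: ler_wpM2l; first by rewrite mulr_ge0 ?exprn_ge0//; lra.
  by rewrite lerXn2r ?nnegrE; lra.
(* The second variable is frozen at its largest value [q] while the first drops from [r] to [t]. *)
have bq : bounded_sums (fun n m k => c' n m k * q ^+ e n m k).
  have := bounded_sums_diff (fun n m k => c n m k * q ^+ e n m k) d t r.
  rewrite (_ : (fun n m k => _ * t ^+ _) = (fun n m k => c' n m k * q ^+ e n m k)).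
    apply=> [n m k||]; first by rewrite mulr_ge0 ?exprn_ge0//; lra.
      by rewrite (ltW t0).
    by apply: bounded_sums_le crq => n m k; rewrite mulrAC.
  by apply/funext => n; apply/funext => m; apply/funext => k; rewrite /c'; ring.
have sq0 : 0 < s < q by rewrite s0.
have H := cvg_derive1_scaled c' e (fun n m k => c' n m k * s ^+ e n m k) f' s q
  c'0 sq0 bq (fun=> erefl) (fun _ _ _ => erefl).
have -> : cubic_sum (fun n m k => w n m k * ((d n m k)%:R * (e n m k)%:R)) =
    fun N => t * cubic_sum (fun n m k => c' n m k * s ^+ e n m k * (e n m k)%:R) N.
  apply/funext => N; rewrite -cubic_sumZ; congr (_ N); apply: eq_cubic_sum => n m k.
  by rewrite wE /c'; case: (d n m k) => [|j] /=; rewrite ?exprS; ring.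
rewrite -mulrA; exact: (cvgM (cvg_cst t) H).
Unshelve. all: by end_near. Qed.

End CubicSums.

(** * Convergence region and determinant condition *)

Lemma conv_region_bounded_sums (R : realType) (a : pser3 R) (y z v : R) :
  conv_region a (y, z, v) -> bounded_sums (pser3_term a y z v).
Proof.
rewrite /conv_region /= /summable; set S := (\esum_(i in _) _)%E => Sfin.
have S0 : (0 <= S)%E by apply: esum_ge0.
exists (fine S) => N; rewrite -lee_fin fineK; last by rewrite ge0_fin_numE.
(* The cube of side [N] is one of the finite sets over which the unordered sum takes its supremum;
   its sum is then split into nested sums. *)
apply: esum_ge; exists (`I_N `*` `I_N `*` `I_N).
  by split => //; apply: finite_setX => //; apply: finite_setX.
pose F n m k : \bar R := `|(pser3_term a y z v n m k)%:E|%E.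
rewrite -(pair_fsbig _ (fun p k => F p.1 p.2 k))//=; last exact: finite_setX.
rewrite -(pair_fsbig _ (fun n m => (\sum_(k \in `I_N) F n m k)%E))//=.
rewrite /cubic_sum -sumEFin -fsbig_ord; apply: lee_sum => n _.
rewrite -sumEFin -fsbig_ord; apply: lee_sum => m _.
rewrite -sumEFin -fsbig_ord; apply: lee_sum => k _.
by rewrite lee_abs.
Qed.

(** Provides the larger point that differentiation in each variable requires. *)
Lemma interior_gt (R : realType) (D : set (R * R * R)) (y z v : R) :
  D° (y, z, v) -> exists y1 z1 v1 : R, [/\ y < y1, z < z1, v < v1 & D (y1, z1, v1)].
Proof.
move=> /nbhs_ballP[e /= e0 De].
exists (y + e / 2), (z + e / 2), (v + e / 2).
split; [lra|lra|lra|]; apply: De.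
have B (x : R) : ball x e (x + e / 2).
  by rewrite /ball /= opprD addrA subrr sub0r normrN gtr0_norm; lra.
by split; [split|]; exact: B.
Qed.

(** If all three rows annihilated the vector [(x, y, z)], invertibility of the matrix over [R] would
    make this vector zero, against [z != 0]. *)
Lemma det_neq0_row (R : realType) (n m k : 'I_3 -> nat) (x y z : R) :
  \det (exponent_mx n m k) != 0 -> z != 0 ->
  exists j, x * (n j)%:R + y * ((m j)%:R - 1) + z * (k j)%:R != 0.
Proof.
move=> det0 z0; apply/existsP; apply: contraNT det0 => /existsPn row0.
pose A : 'M[R]_3 := map_mx intr (exponent_mx n m k).
pose u : 'cV[R]_3 := \col_(c < 3) [:: x; y; z]`_c.
have Au : A *m u = 0.
  apply/matrixP => j c; rewrite [RHS]mxE.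
  have /negPn/eqP <- := row0 j.
  by rewrite !mxE !big_ord_recl big_ord0 !mxE /= rmorphB /= -!pmulrn; ring.
have : A \notin unitmx.
  apply/negP => Aunit; have := mulKmx Aunit u; rewrite Au mulmx0.
  by move/matrixP/(_ ord_max 0); rewrite !mxE /= => /eqP; rewrite eq_sym (negbTE z0).
by rewrite unitmxE unitfE negbK det_map_mx intr_eq0.
Qed.

(** * Moments of the weights as partial derivatives *)

Lemma pser3_term_ge0 (R : realType) (a : pser3 R) (y z v : R) (n m k : nat) :
  (forall n m k, 0 <= a n m k) -> 0 <= y -> 0 <= z -> 0 <= v ->
  0 <= pser3_term a y z v n m k.
Proof. by move=> a0 y0 z0 v0; rewrite !mulr_ge0 ?exprn_ge0. Qed.

Lemma bounded_sums_pser3_le {R : realType} {a : pser3 R} {y z v y' z' v' : R} :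
  (forall n m k, 0 <= a n m k) -> 0 <= y <= y' -> 0 <= z <= z' -> 0 <= v <= v' ->
  bounded_sums (pser3_term a y' z' v') -> bounded_sums (pser3_term a y z v).
Proof.
move=> a0 /andP[y0 yy'] /andP[z0 zz'] /andP[v0 vv']; apply: bounded_sums_le => n m k.
have X (s t : R) (i : nat) : 0 <= s -> s <= t -> s ^+ i <= t ^+ i.
  by move=> s0 st; rewrite lerXn2r ?nnegrE ?(le_trans s0).
do 2?[apply: ler_pM; rewrite ?mulr_ge0 ?exprn_ge0 ?X//].
by apply: ler_wpM2l; rewrite ?X.
Qed.

Lemma pser3_evalE (R : realType) (a : pser3 R) (y z v : R) :
  pser3_eval a y z v = limn (cubic_sum (pser3_term a y z v)).
Proof. by []. Qed.

(** In each case the two other variables are frozen into the coefficients, and monotonicity carries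
    the bound at [(y1, z1, v1)] to the point where only the moving variable is enlarged. *)
Lemma first_moments {R : realType} {a : pser3 R} {y0 z0 y1 z1 v1 : R}
  (F := pser3_eval a) (w := pser3_term a y0 z0 1) :
  (forall n m k, 0 <= a n m k) -> 0 < y0 < y1 -> 0 < z0 < z1 -> 1 < v1 ->
  bounded_sums (pser3_term a y1 z1 v1) ->
  [/\ cubic_sum (fun n m k => w n m k * m%:R) @ \oo --> y0 * partial_y F y0 z0 1,
      cubic_sum (fun n m k => w n m k * n%:R) @ \oo --> z0 * partial_z F y0 z0 1 &
      cubic_sum (fun n m k => w n m k * k%:R) @ \oo --> partial_v F y0 z0 1].
Proof.
move=> a0 yy zz vv bd.
have bounded y z v yy' zz' vv' :=
  @bounded_sums_pser3_le R a y z v _ _ _ a0 yy' zz' vv' bd.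
split.
- apply: (cvg_derive1_scaled (fun n m k => a n m k * z0 ^+ n * 1 ^+ k)
    (fun _ m _ => m) w _ y0 y1); [move=> n m k|exact: yy| |move=> s|move=> n m k].
  + by rewrite !mulr_ge0 ?exprn_ge0//; lra.
  + apply: bounded_sums_le (bounded y1 z0 1 _ _ _) => [n m k|||]; [|lra..].
    by rewrite /pser3_term mulrAC.
  + rewrite /F pser3_evalE; congr (limn _); apply: eq_cubic_sum => *.
    by rewrite /pser3_term; ring.
  + by rewrite /w /pser3_term; ring.
- apply: (cvg_derive1_scaled (fun n m k => a n m k * y0 ^+ m * 1 ^+ k)
    (fun n _ _ => n) w _ z0 z1); [move=> n m k|exact: zz| |move=> s|move=> n m k].
  + by rewrite !mulr_ge0 ?exprn_ge0//; lra.
  + apply: bounded_sums_le (bounded y0 z1 1 _ _ _) => [n m k|||]; [|lra..].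
    by rewrite /pser3_term; lra.
  + rewrite /F pser3_evalE; congr (limn _); apply: eq_cubic_sum => *.
    by rewrite /pser3_term; ring.
  + by rewrite /w /pser3_term; ring.
(* Since [v] is taken at 1, the factor [t = 1] expected by [cvg_derive1_scaled] has to be
   inserted. *)
- rewrite -[X in _ --> X]mul1r.
  apply: (cvg_derive1_scaled (fun n m k => a n m k * z0 ^+ n * y0 ^+ m)
    (fun _ _ k => k) w _ 1 v1); [move=> n m k| | |move=> s|move=> n m k].
  + by rewrite !mulr_ge0 ?exprn_ge0//; lra.
  + by lra.
  + apply: bounded_sums_le (bounded y0 z0 v1 _ _ _) => [n m k|||]; [|lra..].
    by rewrite /pser3_term.
  + by rewrite /F pser3_evalE.
  + by rewrite /w /pser3_term.
Qed.

(** Factorial moments rather than squares, since these are what pure second derivatives produce. *)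
Lemma second_moments {R : realType} {a : pser3 R} {y0 z0 y1 z1 v1 : R}
  (F := pser3_eval a) (w := pser3_term a y0 z0 1) :
  (forall n m k, 0 <= a n m k) -> 0 < y0 < y1 -> 0 < z0 < z1 -> 1 < v1 ->
  bounded_sums (pser3_term a y1 z1 v1) ->
  [/\ cubic_sum (fun n m k => w n m k * (m%:R * (m%:R - 1))) @ \oo -->
        y0 ^+ 2 * partial_y (partial_y F) y0 z0 1,
      cubic_sum (fun n m k => w n m k * (n%:R * (n%:R - 1))) @ \oo -->
        z0 ^+ 2 * partial_z (partial_z F) y0 z0 1 &
      cubic_sum (fun n m k => w n m k * (k%:R * (k%:R - 1))) @ \oo -->
        partial_v (partial_v F) y0 z0 1].
Proof.
move=> a0 yy zz vv bd.
have bounded y z v yy' zz' vv' :=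
  @bounded_sums_pser3_le R a y z v _ _ _ a0 yy' zz' vv' bd.
split.
- apply: (cvg_derive1_derive1_scaled (fun n m k => a n m k * z0 ^+ n * 1 ^+ k)
    (fun n m k => m) w _ y0 y1); [move=> n m k| | |move=> s|move=> n m k].
  + by rewrite !mulr_ge0 ?exprn_ge0//; lra.
  + by lra.
  + apply: bounded_sums_le (bounded y1 z0 1 _ _ _) => [n m k|||]; [|lra..].
    by rewrite /pser3_term; lra.
  + rewrite /F pser3_evalE; congr (limn _); apply: eq_cubic_sum => *.
    by rewrite /pser3_term; ring.
  + by rewrite /w /pser3_term; ring.
- apply: (cvg_derive1_derive1_scaled (fun n m k => a n m k * y0 ^+ m * 1 ^+ k)
    (fun n m k => n) w _ z0 z1); [move=> n m k| | |move=> s|move=> n m k].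
  + by rewrite !mulr_ge0 ?exprn_ge0//; lra.
  + by lra.
  + apply: bounded_sums_le (bounded y0 z1 1 _ _ _) => [n m k|||]; [|lra..].
    by rewrite /pser3_term; lra.
  + rewrite /F pser3_evalE; congr (limn _); apply: eq_cubic_sum => *.
    by rewrite /pser3_term; ring.
  + by rewrite /w /pser3_term; ring.
- rewrite -[X in _ --> X]mul1r -[X in X * _](expr1n R 2).
  apply: (cvg_derive1_derive1_scaled (fun n m k => a n m k * z0 ^+ n * y0 ^+ m)
    (fun n m k => k) w _ 1 v1); [move=> n m k| | |move=> s|move=> n m k].
  + by rewrite !mulr_ge0 ?exprn_ge0//; lra.
  + by lra.
  + apply: bounded_sums_le (bounded y0 z0 v1 _ _ _) => [n m k|||]; [|lra..].
    by rewrite /pser3_term; lra.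
  + by rewrite /F pser3_evalE.
  + by rewrite /w /pser3_term.
Qed.

(** The variable of the first exponent is the one differentiated first, in the order used by
    [sigma2]. *)
Lemma mixed_moments {R : realType} {a : pser3 R} {y0 z0 y1 z1 v1 : R}
  (F := pser3_eval a) (w := pser3_term a y0 z0 1) :
  (forall n m k, 0 <= a n m k) -> 0 < y0 < y1 -> 0 < z0 < z1 -> 1 < v1 ->
  bounded_sums (pser3_term a y1 z1 v1) ->
  [/\ cubic_sum (fun n m k => w n m k * (m%:R * n%:R)) @ \oo -->
        y0 * z0 * partial_z (partial_y F) y0 z0 1,
      cubic_sum (fun n m k => w n m k * (m%:R * k%:R)) @ \oo -->
        y0 * partial_v (partial_y F) y0 z0 1 &
      cubic_sum (fun n m k => w n m k * (n%:R * k%:R)) @ \oo -->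
        z0 * partial_v (partial_z F) y0 z0 1].
Proof.
move=> a0 yy zz vv bd.
have bounded y z v yy' zz' vv' :=
  @bounded_sums_pser3_le R a y z v _ _ _ a0 yy' zz' vv' bd.
split.
- apply: (cvg_derive1_derive1_mixed (fun n m k => a n m k * 1 ^+ k)
    (fun n m k => m) (fun n m k => n) w (fun y z => F y z 1) y0 y1 z0 z1);
    [move=> n m k| | | |move=> x y|move=> n m k].
  + by rewrite !mulr_ge0 ?exprn_ge0//; lra.
  + by lra.
  + by lra.
  + apply: bounded_sums_le (bounded y1 z1 1 _ _ _) => [n m k|||]; [|lra..].
    by rewrite /pser3_term; lra.
  + rewrite /F pser3_evalE; congr (limn _); apply: eq_cubic_sum => *.
    by rewrite /pser3_term; ring.
  + by rewrite /w /pser3_term; ring.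
- rewrite -[y0 in y0 * _]mulr1.
  apply: (cvg_derive1_derive1_mixed (fun n m k => a n m k * z0 ^+ n)
    (fun n m k => m) (fun n m k => k) w (fun y v => F y z0 v) y0 y1 1 v1);
    [move=> n m k| | | |move=> x y|move=> n m k].
  + by rewrite !mulr_ge0 ?exprn_ge0//; lra.
  + by lra.
  + by lra.
  + apply: bounded_sums_le (bounded y1 z0 v1 _ _ _) => [n m k|||]; [|lra..].
    by rewrite /pser3_term; lra.
  + by rewrite /F pser3_evalE.
  + by rewrite /w /pser3_term.
- rewrite -[z0 in z0 * _]mulr1.
  apply: (cvg_derive1_derive1_mixed (fun n m k => a n m k * y0 ^+ m)
    (fun n m k => n) (fun n m k => k) w (fun z v => F y0 z v) z0 z1 1 v1);
    [move=> n m k| | | |move=> x y|move=> n m k].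
  + by rewrite !mulr_ge0 ?exprn_ge0//; lra.
  + by lra.
  + by lra.
  + apply: bounded_sums_le (bounded y0 z1 v1 _ _ _) => [n m k|||]; [|lra..].
    by rewrite /pser3_term; lra.
  + rewrite /F pser3_evalE; congr (limn _); apply: eq_cubic_sum => *.
    by rewrite /pser3_term; ring.
  + by rewrite /w /pser3_term; ring.
Qed.

(** * Positivity of [sigma2] as a weighted sum of squares *)

Theorem lemma4 (R : realType) (a : pser3 R)
  (a_ge0 : forall n m k : nat, 0 <= a n m k)
  (awf : analytically_well_founded_at1 a)
  (y0 z0 : R) (sol : characteristic_point a y0 z0)
  (n m k : 'I_3 -> nat)
  (m_gt0 : forall j : 'I_3, (0 < m j)%N)
  (det_neq0 : \det (exponent_mx n m k) != 0)
  (a_neq0 : forall j : 'I_3, a (n j) (m j) (k j) != 0) :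
  0 < sigma2 a y0 z0.
Proof.
case: awf => _ [n2 [m2 [k2 Fyy_neq0]]] [n1 [m1 [k1 Fz_neq0]]] _.
case: sol => y0_gt0 z0_gt0 /interior_gt [y1 [z1 [v1 [yy zz vv]]]].
move=> /conv_region_bounded_sums bd y0E Fy1.
have yy' : 0 < y0 < y1 by rewrite y0_gt0.
have zz' : 0 < z0 < z1 by rewrite z0_gt0.
have [Tm Tn Tk] := first_moments a_ge0 yy' zz' vv bd.
have [Tmm Tnn Tkk] := second_moments a_ge0 yy' zz' vv bd.
have [Tmn Tmk Tnk] := mixed_moments a_ge0 yy' zz' vv bd.
have w_ge0 i j l : 0 <= pser3_term a y0 z0 1 i j l.
  by apply: pser3_term_ge0 => //; exact: ltW.
have w_gt0 i j l : a i j l != 0 -> 0 < pser3_term a y0 z0 1 i j l.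
  move=> aijl; rewrite /pser3_term expr1n mulr1 !mulr_gt0 ?exprn_gt0//.
  by rewrite lt0r aijl a_ge0.
have T1 : cubic_sum (pser3_term a y0 z0 1) @ \oo --> y0.
  rewrite [X in _ --> X]y0E pser3_evalE; apply: cubic_sum_cvg => //.
  by apply: (bounded_sums_pser3_le a_ge0 _ _ _ bd); lra.
(* Since [F_y = 1], the first moment of [m] is [y0], which is also the total mass: [m - 1] has mean
   0. *)
rewrite /sigma2 /mu; rewrite -{}Fy1 mulr1 in Tm.
move: w_ge0 w_gt0 T1 Tm Tn Tk Tmm Tnn Tkk Tmn Tmk Tnk => /=.
set w := pser3_term a y0 z0 1; set F := pser3_eval a.
set Fz := partial_z F y0 z0 1; set Fv := partial_v F y0 z0 1.
set Fyy := partial_y _ _ _ _; set Fzz := partial_z (partial_z _) _ _ _.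
set Fvv := partial_v (partial_v _) _ _ _.
set Fyz := partial_z (partial_y _) _ _ _; set Fyv := partial_v (partial_y _) _ _ _.
set Fzv := partial_v (partial_z _) _ _ _.
move=> w_ge0 w_gt0 T1 Tm Tn Tk Tmm Tnn Tkk Tmn Tmk Tnk.
have Fz_gt0 : 0 < Fz.
  (* A nonzero coefficient of the formal derivative comes from the coefficient of [a] with the
     exponent of [z] raised by one; its weight makes a positive term in the sum for [z0 * Fz]. *)
  have a1 : a n1.+1 m1 k1 != 0 by move: Fz_neq0; rewrite mulf_eq0 negb_or => /andP[].
  rewrite -(pmulr_rgt0 _ z0_gt0).
  apply: lt_le_trans (term_le_cubic_lim _ _ n1.+1 m1 k1 _ Tn) => [|i j l].
    by rewrite mulr_gt0 ?w_gt0.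
  by rewrite mulr_ge0.
have natrB1 (i : nat) : 0 <= i%:R * (i%:R - 1) :> R.
  by case: i => [|i]; rewrite ?mul0r// -natr1 addrK mulr_ge0// addr_ge0.
have Fyy_gt0 : 0 < Fyy.
  (* After the shift by two, the factor [m (m - 1)] is positive at this exponent. *)
  have a2 : a n2 m2.+2 k2 != 0.
    by move: Fyy_neq0; rewrite !mulf_eq0 !negb_or => /and3P[].
  rewrite -(pmulr_rgt0 _ (exprn_gt0 2 y0_gt0)).
  apply: lt_le_trans (term_le_cubic_lim _ _ n2 m2.+2 k2 _ Tmm) => [|i j l].
    by rewrite mulr_gt0 ?w_gt0// -[X in _ - X]/(1%:R) -natrB// mulr_gt0 ?ltr0n.
  by rewrite mulr_ge0.
(* The sums of [w (k - mu0 n)(m - 1)] and [w (m - 1)^2] are [y0 (Fyv - mu0 z0 Fyz)] and [y0^2 Fyy],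
   because [mu0 z0 Fz = Fv]; their quotient is the regression coefficient [la]. *)
pose mu0 := Fv / (z0 * Fz); pose la := (Fyv - mu0 * z0 * Fyz) / (y0 * Fyy).
have [j jP] := det_neq0_row R n m k (- mu0) (- la) 1 det_neq0 (oner_neq0 R).
(* The sum of [w X^2] for the full residual [X] posed next, expanded with [n^2 = n(n-1) + n] and
   likewise for [k]; in [(m-1)^2 = m(m-1) - m + 1] the last two terms cancel after summation. *)
pose q := mu0 ^+ 2 * (z0 ^+ 2 * Fzz + z0 * Fz) + la ^+ 2 * (y0 ^+ 2 * Fyy) +
  (Fvv + Fv) + 2 * mu0 * la * (y0 * z0 * Fyz - z0 * Fz) - 2 * mu0 * (z0 * Fzv) -
  2 * la * (y0 * Fyv - Fv).
pose X n m k : R := - mu0 * n%:R + - la * (m%:R - 1) + 1 * k%:R.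
have Tq : cubic_sum (fun n m k => w n m k * X n m k ^+ 2) @ \oo --> q.
  have Xnn := cvg_cubic_sumZ (mu0 ^+ 2) (cvg_cubic_sumD Tnn Tn).
  have Xmm := cvg_cubic_sumZ (la ^+ 2)
    (cvg_cubic_sumD Tmm (cvg_cubic_sumD (cvg_cubic_sumZ (-1) Tm) T1)).
  have Xkk := cvg_cubic_sumD Tkk Tk.
  have Xnm := cvg_cubic_sumZ (2 * mu0 * la)
    (cvg_cubic_sumD Tmn (cvg_cubic_sumZ (-1) Tn)).
  have Xnk := cvg_cubic_sumZ (- (2 * mu0)) Tnk.
  have Xmk := cvg_cubic_sumZ (- (2 * la))
    (cvg_cubic_sumD Tmk (cvg_cubic_sumZ (-1) Tk)).
  have := cvg_cubic_sumD (cvg_cubic_sumD (cvg_cubic_sumD Xnn Xmm) Xkk)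
    (cvg_cubic_sumD Xnm (cvg_cubic_sumD Xnk Xmk)).
  rewrite (eq_cubic_sum _ (fun n m k => w n m k * X n m k ^+ 2)).
    by rewrite [X in _ --> X](_ : _ = q)// /q; ring.
  by move=> i j' l; rewrite /X; ring.
have q_gt0 : 0 < q.
  (* The triple of index [j] has positive weight and nonzero residual. *)
  apply: lt_le_trans (term_le_cubic_lim _ _ (n j) (m j) (k j) _ Tq) => [|i j' l].
    by rewrite mulr_gt0 ?w_gt0// lt0r sqr_ge0 sqrf_eq0 jP.
  by rewrite mulr_ge0 ?sqr_ge0.
(* Here [z0 * Fz] is [y0 E[n]] and [q] is [y0] times the mean squared residual; the equality is a
   rational identity in the derivatives. *)
rewrite [X in _ < X](_ : _ = q / (z0 * Fz)); first by rewrite divr_gt0 ?mulr_gt0.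
rewrite /q /la /mu0; field.
by rewrite !gt_eqF.
Qed.
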